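(* Assume that the vector fields $F_j:=\nabla u_j$ are such that $|F_j|$ is bounded from below by a positive constant on $\bar X$ for all $1\le j\le J$. Then the operator $\mathcal A_J$ (the linearized power-density operator with principal symbol $\mathfrak p_J$ given in the context) is elliptic in $\bar X$, i.e. the $2J\times(J+1)$ matrix $\mathfrak p_J(x,\xi)$ has rank $J+1$ for all $x\in\bar X$ and all $\xi\in\mathbb S^{n-1}$, if and only if the family of quadratic forms $\{q_j\}_{1\le j\le J}$ is elliptic in $\bar X$.
   Context: $X\subset\mathbb R^n$, $n\ge 2$, is a bounded open domain with smooth boundary; $\gamma$ is a sufficiently regular real scalar coefficient on $\bar X$ bounded above and below by positive constants; $u_1,\dots,u_J$ are (sufficiently regular, real-valued) solutions of $\nabla\cdot\gamma\nabla u_j=0$ in $X$ with Dirichlet data $u_j=f_j$ on $\partial X$. Set $F_j=\nabla u_j$ and $\hat F_j=F_j/|F_j|$. The operator $\mathcal A_J$ is the differential operator acting on $(\delta\gamma,\delta u_1,\dots,\delta u_J)$ whose $2J$ rows are, for $1\le j\le J$, $$\delta\gamma\,|F_j|^2+2\gamma F_j\cdot\nabla\delta u_j,\qquad \nabla\cdot(\delta\gamma F_j)+\nabla\cdot(\gamma\nabla\delta u_j).$$ It is considered in the Douglis–Nirenberg sense: rows of the first type have weight $s=0$, rows of the second type have weight $s=1$, the column $\delta\gamma$ has weight $t=0$ and the columns $\delta u_j$ have weight $t=1$ (up to a common shift of the $s$'s compensated in the $t$'s); the principal part keeps in row $i$, column $k$ only the terms of order exactly $s_i+t_k$. The resulting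 principal symbol $\mathfrak p_J(x,\xi)$ is the $2J\times(J+1)$ matrix whose two rows of index $j$ are: $|F_j|^2$ in the $\delta\gamma$ column, $2\gamma F_j\cdot i\xi$ in the $\delta u_j$ column and $0$ elsewhere; and $F_j\cdot i\xi$ in the $\delta\gamma$ column, $-\gamma|\xi|^2$ in the $\delta u_j$ column and $0$ elsewhere. Quadratic forms: $q_j(x,\xi)=2(\hat F_j(x)\cdot\xi)^2-|\xi|^2$ for $\xi\in\mathbb R^n$. The family $\{q_j\}_{1\le j\le J}$ is elliptic at $x$ if ($q_j(x,\xi)=0$ for all $1\le j\le J$) implies $\xi=0$; it is elliptic in $\bar X$ if it is elliptic at every $x\in\bar X$. *)

(* Defs.v *)
From mathcomp Require Import all_boot all_order all_algebra.
From mathcomp Require Import all_classical all_reals all_analysis.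
From mathcomp Require Import complex.

Set Implicit Arguments.
Unset Strict Implicit.
Unset Printing Implicit Defensive.

Import Order.TTheory GRing.Theory Num.Theory.
Import numFieldNormedType.Exports.

Local Open Scope classical_set_scope.
Local Open Scope ring_scope.
Local Open Scope complex_scope.

Section Euclidean.
Context {R : realType} {n : nat}.
Implicit Types v w : 'rV[R]_n.

Definition dot v w : R := \sum_(i < n) v 0 i * w 0 i.

(* The norm `|v| that the library puts on 'rV[R]_n is the sup norm; the
   Euclidean norm is needed here. *)
Definition enorm v : R := Num.sqrt (dot v v).

Lemma sqr_enorm v : enorm v ^+ 2 = dot v v.
Proof. by rewrite sqr_sqrtr// sumr_ge0// => i _; rewrite -expr2 sqr_ge0. Qed.

End Euclidean.

Section Calculus.
Context {R : realType} {n : nat}.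
Implicit Types (f : 'rV[R]_n -> R) (V : 'rV[R]_n -> 'rV[R]_n).
Implicit Types (a : seq 'I_n) (U X : set 'rV[R]_n).

Definition grad f (x : 'rV[R]_n) : 'rV[R]_n := \row_(i < n) 'D_'e_i f x.

Definition div V (x : 'rV[R]_n) : R :=
  \sum_(i < n) 'D_'e_i (fun y => V y 0 i) x.

(* pderiv [:: i_1; ..; i_m] f = d_{i_1} .. d_{i_m} f *)
Definition pderiv a f : 'rV[R]_n -> R :=
  foldr (fun i g => fun x : 'rV[R]_n => 'D_'e_i g x) f a.

Definition Ck (k : nat) U f : Prop := forall a, (size a <= k)%N ->
  (forall x, U x -> {for x, continuous (pderiv a f)}) /\
  ((size a < k)%N ->
    forall i x, U x -> derivable (pderiv a f) x ('e_i : 'rV[R]_n)).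

(* f is C^k up to the boundary of X: it is (the restriction of) a C^k function
   on an open neighbourhood of closure X. *)
Definition Ck_closure (k : nat) X f : Prop :=
  exists U, [/\ open U, closure X `<=` U & Ck k U f].

Definition frontier X : set 'rV[R]_n := closure X `\` interior X.

(* Near each boundary point, X is a strict sublevel set of a C^oo function
   with nonvanishing gradient. *)
Definition smooth_boundary X : Prop := forall p, frontier X p ->
  exists U (rho : 'rV[R]_n -> R),
    [/\ open U /\ U p, forall k, Ck k U rho, grad rho p != 0 &
        forall x, U x -> (X x <-> rho x < 0)].

Record bounded_smooth_domain X : Prop := BoundedSmoothDomain {
  domain_nonempty : X !=set0;
  domain_open : open X;
  domain_connected : connected X;
  domain_bounded : bounded_set X;
  domain_smooth : smooth_boundary X }.

End Calculus.

Section DouglisNirenberg.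
Context {R : realType} {n : nat}.

(* A scalar linear differential operator with real variable coefficients is
   given by its coefficients: P [:: i_1; ..; i_m] is the coefficient of
   d_{i_1} .. d_{i_m}. *)
Definition diffop := seq 'I_n -> 'rV[R]_n -> R.

(* Action of P on f when P has order at most d. *)
Definition diffop_app (d : nat) (P : diffop) (f : 'rV[R]_n -> R) x : R :=
  \sum_(m < d.+1) \sum_(a : m.-tuple 'I_n) P a x * pderiv a f x.

(* Symbol of the part of P of order exactly m: d_k becomes i xi_k. *)
Definition symbol_of_order (m : nat) (P : diffop) (x xi : 'rV[R]_n) : R[i] :=
  \sum_(a : m.-tuple 'I_n) (P a x)%:C * \prod_(k <- a) ('i * (xi 0 k)%:C).

Definition diffsys (M N : nat) := 'I_M -> 'I_N -> diffop.

Definition diffsys_app M N (d : nat) (P : diffsys M N)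
    (f : 'I_N -> 'rV[R]_n -> R) (r : 'I_M) x : R :=
  \sum_(k < N) diffop_app d (P r k) (f k) x.

Section Weights.
Variables (M N : nat) (s : 'I_M -> nat) (t : 'I_N -> nat) (P : diffsys M N).

Definition DN_order : Prop := forall r k a x,
  (s r + t k < size a)%N -> P r k a x = 0.

Definition DN_symbol (x xi : 'rV[R]_n) : 'M[R[i]]_(M, N) :=
  \matrix_(r, k) symbol_of_order (s r + t k) (P r k) x xi.

Definition DN_elliptic (D : set 'rV[R]_n) : Prop :=
  forall x xi, D x -> enorm xi = 1 -> \rank (DN_symbol x xi) = N.

End Weights.
End DouglisNirenberg.

Section PowerDensity.
Context {R : realType} {n J : nat}.
Variables (g : 'rV[R]_n -> R) (F : 'I_J -> 'rV[R]_n -> 'rV[R]_n).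

(* Rows: lshift J j is the power-density row of index j, rshift J j the PDE
   row of index j.  Columns: lshift J 0 is (delta gamma), rshift 1 j is
   (delta u_j). *)

Definition AJ_action (dg : 'rV[R]_n -> R) (du : 'I_J -> 'rV[R]_n -> R)
    (r : 'I_(J + J)) (x : 'rV[R]_n) : R :=
  match fintype.split r with
  | inl j => dg x * enorm (F j x) ^+ 2
             + 2 * g x * dot (F j x) (grad (du j) x)
  | inr j => div (fun y => dg y *: F j y) x
             + div (fun y => g y *: grad (du j) y) x
  end.

(* Coefficients of AJ_action (see AJ_appE), with the divergences expanded. *)
Definition AJ : diffsys (n := n) (R := R) (J + J) (1 + J) := fun r k =>
  match fintype.split r, fintype.split k with
  | inl j, inl _ => fun a x =>
      if a is [::] then enorm (F j x) ^+ 2 else 0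
  | inl j, inr l => fun a x =>
      if a is [:: i] then (if l == j then 2 * g x * F j x 0 i else 0) else 0
  | inr j, inl _ => fun a x =>
      match a with
      | [::] => div (F j) x
      | [:: i] => F j x 0 i
      | _ => 0
      end
  | inr j, inr l => fun a x =>
      if l != j then 0 else
      match a with
      | [:: i] => grad g x 0 i
      | [:: i; i'] => if i == i' then g x else 0
      | _ => 0
      end
  end.

Definition AJ_args (dg : 'rV[R]_n -> R) (du : 'I_J -> 'rV[R]_n -> R)
    (k : 'I_(1 + J)) : 'rV[R]_n -> R :=
  match fintype.split k with inl _ => dg | inr j => du j end.

Definition AJ_s (r : 'I_(J + J)) : nat :=
  match fintype.split r with inl _ => 0 | inr _ => 1 end.

Definition AJ_t (k : 'I_(1 + J)) : nat :=
  match fintype.split k with inl _ => 0 | inr _ => 1 end.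

Definition pJ (x xi : 'rV[R]_n) : 'M[R[i]]_(J + J, 1 + J) :=
  block_mx
    (\matrix_(j < J, _ < 1) (enorm (F j x) ^+ 2)%:C)
    (\matrix_(j < J, l < J)
       (if l == j then (2 * g x)%:C * ('i * (dot (F j x) xi)%:C) else 0))
    (\matrix_(j < J, _ < 1) ('i * (dot (F j x) xi)%:C))
    (\matrix_(j < J, l < J)
       (if l == j then - (g x * enorm xi ^+ 2)%:C else 0)).

Lemma sum_tuple0 (T : nmodType) (G : seq 'I_n -> T) :
  \sum_(a : 0.-tuple 'I_n) G a = G [::].
Proof.
rewrite (bigD1 [tuple])//= big1 ?addr0// => a /negP[].
by rewrite (tuple0 a).
Qed.

Lemma sum_tupleS (T : nmodType) (G : seq 'I_n -> T) m :
  \sum_(a : m.+1.-tuple 'I_n) G a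
  = \sum_(i < n) \sum_(a : m.-tuple 'I_n) G (i :: a).
Proof.
rewrite pair_big/=.
rewrite (reindex (fun p : 'I_n * m.-tuple 'I_n => [tuple of p.1 :: p.2]))//=.
exists (fun a : m.+1.-tuple 'I_n => (thead a, [tuple of behead a])).
  by move=> [i a] _; congr (_, _); apply: val_inj.
by move=> a _; rewrite [RHS]tuple_eta; apply: val_inj.
Qed.

Lemma AJ_appE dg du r x :
  (forall i, derivable dg x ('e_i : 'rV[R]_n)) ->
  (forall i, derivable g x ('e_i : 'rV[R]_n)) ->
  (forall j i, derivable (fun y => F j y 0 i) x ('e_i : 'rV[R]_n)) ->
  (forall j i, derivable (pderiv [:: i] (du j)) x ('e_i : 'rV[R]_n)) ->
  diffsys_app 2 AJ (AJ_args dg du) r x = AJ_action dg du r x.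
Proof.
move=> hdg hg hF hdu.
have sl m p (i : 'I_m) : fintype.split (lshift p i) = inl i.
  by rewrite -[lshift p i]/(unsplit (inl i)) unsplitK.
have sr m p (i : 'I_p) : fintype.split (rshift m i) = inr i.
  by rewrite -[rshift m i]/(unsplit (inr i)) unsplitK.
rewrite /diffsys_app big_split_ord big_ord1.
under eq_bigr do rewrite /AJ_args /AJ sr.
rewrite /AJ_args /AJ /AJ_action sl.
have app2 (P : diffop) f : diffop_app 2 P f x = P [::] x * f x
    + \sum_i P [:: i] x * 'D_'e_i f x
    + \sum_i \sum_i' P [:: i; i'] x * 'D_'e_i (fun y : 'rV[R]_n => 'D_'e_i' f y) x.
  rewrite /diffop_app !big_ord_recl big_ord0 addr0 addrA; congr (_ + _ + _).
  - by rewrite (sum_tuple0 (fun a => P a x * pderiv a f x)).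
  - rewrite (sum_tupleS (fun a => P a x * pderiv a f x)).
    apply: eq_bigr => i _.
    by rewrite (sum_tuple0 (fun a => P (i :: a) x * pderiv (i :: a) f x)).
  - rewrite (sum_tupleS (fun a => P a x * pderiv a f x)).
    apply: eq_bigr => i _.
    rewrite (sum_tupleS (fun a => P (i :: a) x * pderiv (i :: a) f x)).
    apply: eq_bigr => i' _.
    by rewrite (sum_tuple0
      (fun a => P (i :: i' :: a) x * pderiv (i :: i' :: a) f x)).
have sum0 (G : 'I_n -> R) : \sum_i 0 * G i = 0.
  by rewrite big1// => i _; rewrite mul0r.
have sum00 (G : 'I_n -> 'I_n -> R) : \sum_i \sum_i' 0 * G i i' = 0.
  by rewrite big1// => i _; exact: sum0.
case: (fintype.split r) => j; rewrite app2.
  rewrite sum0 sum00 !addr0 mulrC; congr (_ + _).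
  rewrite (bigD1 j)//= [X in _ + X]big1 ?addr0; last first.
    move=> l /negbTE lj; rewrite app2 lj.
    by rewrite mul0r sum0 sum00 !addr0.
  rewrite app2 eqxx mul0r add0r sum00 addr0 /dot mulr_sumr.
  by apply: eq_bigr => i _; rewrite !mxE !mulrA.
rewrite sum00 addr0; congr (_ + _).
  rewrite /div mulr_suml -big_split/=; apply: eq_bigr => i _.
  have -> : (fun y => (dg y *: F j y) 0 i) = dg * (fun y => F j y 0 i).
    by apply/funext => y; rewrite mxE.
  by rewrite (deriveM (hdg i) (hF j i)); congr (_ + _); exact: mulrC.
rewrite (bigD1 j)//= [X in _ + X]big1 ?addr0; last first.
  move=> l /negbTE lj; rewrite app2 lj/=.
  by rewrite mul0r sum0 sum00 !addr0.
rewrite app2 eqxx/= mul0r add0r /div -big_split/=; apply: eq_bigr => i _.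
have -> : (fun y => (g y *: grad (du j) y) 0 i) = g * pderiv [:: i] (du j).
  by apply/funext => y; rewrite !mxE.
rewrite (deriveM (hg i) (hdu j i)) !mxE addrC.
congr (_ + _); last exact: mulrC.
rewrite (bigD1 i)//= eqxx big1 ?addr0// => i' /negbTE; rewrite eq_sym => ->.
by rewrite mul0r.
Qed.

Lemma AJ_DN_order : DN_order AJ_s AJ_t AJ.
Proof.
move=> r k a x; rewrite /AJ_s /AJ_t /AJ.
case: (fintype.split r) => j; case: (fintype.split k) => l.
all: by case: a => [|i [|i' [|? a]]]//=; case: ifP.
Qed.

Lemma AJ_symbolE x xi : DN_symbol AJ_s AJ_t AJ x xi = pJ x xi.
Proof.
pose T (P : diffop (R := R)) (a : seq 'I_n) : R[i] :=
  (P a x)%:C * \prod_(k <- a) ('i * (xi 0 k)%:C).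
have symb0 P : symbol_of_order 0 P x xi = (P [::] x)%:C.
  by rewrite /symbol_of_order (sum_tuple0 (T P)) /T big_nil mulr1.
have symb1 P : symbol_of_order 1 P x xi
    = 'i * (\sum_i P [:: i] x * xi 0 i)%:C.
  rewrite /symbol_of_order (sum_tupleS (T P)) rmorph_sum mulr_sumr.
  apply: eq_bigr => i _.
  by rewrite (sum_tuple0 (fun a => T P (i :: a))) /T big_seq1 rmorphM mulrCA.
have symb2 P : symbol_of_order 2 P x xi
    = - (\sum_i \sum_i' P [:: i; i'] x * (xi 0 i * xi 0 i'))%:C.
  rewrite /symbol_of_order (sum_tupleS (T P)) rmorph_sum -sumrN.
  apply: eq_bigr => i _; rewrite (sum_tupleS (fun a => T P (i :: a))).
  rewrite rmorph_sum -sumrN; apply: eq_bigr => i' _.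
  rewrite (sum_tuple0 (fun a => T P (i :: i' :: a))) /T big_cons big_seq1.
  by rewrite mulrACA -expr2 sqr_i !rmorphM mulN1r mulrN.
have sum0 (G : 'I_n -> R) : \sum_i 0 * G i = 0.
  by rewrite big1// => i _; rewrite mul0r.
apply/matrixP => r k; rewrite /pJ /block_mx /col_mx 2!mxE /AJ_s /AJ_t /AJ.
case: (fintype.split r) => j; rewrite /row_mx mxE;
  case: (fintype.split k) => l; rewrite mxE ?addn0 ?add0n ?addn1.
- by rewrite symb0.
- rewrite symb1; case: (l == j); last by rewrite sum0 mulr0.
  rewrite mulrCA -rmorphM; congr ('i * _%:C).
  by rewrite /dot mulr_sumr; apply: eq_bigr => i _; rewrite mulrA.
- by rewrite symb1.
- rewrite symb2; case: (l == j) => /=; last first.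
    by rewrite big1 ?oppr0// => i _; exact: sum0.
  congr (- _%:C); rewrite sqr_enorm /dot mulr_sumr; apply: eq_bigr => i _.
  rewrite (bigD1 i)//= eqxx big1 ?addr0// => i' /negbTE.
  by rewrite eq_sym => ->; rewrite mul0r.
Qed.

End PowerDensity.

Section QuadraticForms.
Context {R : realType} {n J : nat}.

Definition qform (F : 'I_J -> 'rV[R]_n -> 'rV[R]_n)
    (j : 'I_J) (x xi : 'rV[R]_n) : R :=
  2 * dot ((enorm (F j x))^-1 *: F j x) xi ^+ 2 - enorm xi ^+ 2.

Definition quad_elliptic_at (q : 'I_J -> 'rV[R]_n -> 'rV[R]_n -> R) x : Prop :=
  forall xi, (forall j, q j x xi = 0) -> xi = 0.

Definition quad_elliptic (q : 'I_J -> 'rV[R]_n -> 'rV[R]_n -> R)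
    (D : set 'rV[R]_n) : Prop := forall x, D x -> quad_elliptic_at q x.

End QuadraticForms.

(* Main.v *)
Require Import Defs.
From mathcomp Require Import all_boot all_order all_algebra.
From mathcomp Require Import all_classical all_reals all_analysis.
From mathcomp Require Import complex.
From mathcomp Require Import ring.

Set Implicit Arguments.
Unset Strict Implicit.
Unset Printing Implicit Defensive.

Import Order.TTheory GRing.Theory Num.Theory.
Import numFieldNormedType.Exports.

Local Open Scope classical_set_scope.
Local Open Scope ring_scope.

(** Fix a point x and a covector xi.  A column vector (a, b_1, .., b_J) lies in
the kernel of the principal symbol when, for every j,
   |F_j|^2 a + 2 gamma (i F_j.xi) b_j = 0   and
   (i F_j.xi) a - gamma |xi|^2 b_j = 0.
Since gamma |xi|^2 is nonzero, the second equation determines b_j from a, so the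
kernel is at most a line, and it is nontrivial exactly when a = 1 is admissible.
Substituting b_j in the first equation turns i^2 = -1 into the sign that gives
   |F_j|^2 |xi|^2 - 2 (F_j.xi)^2 = 0,
that is - |F_j|^2 q_j(x, xi) = 0.  As F_j does not vanish, the symbol therefore
fails to have full column rank at (x, xi) exactly when xi is a common zero of
the q_j ([rank_pJ]).  The rank condition quantifies over unit covectors only,
whereas ellipticity of the forms quantifies over all nonzero ones; the two agree
because each q_j is homogeneous of degree two ([quad_elliptic_at_unit]). *)

(** * Homogeneity of the quadratic forms *)

Section Homogeneity.
Context {R : realType} {n : nat}.
Implicit Types (v w xi : 'rV[R]_n) (c : R).

Lemma dotZl c v w : dot (c *: v) w = c * dot v w.
Proof.
by rewrite /dot mulr_sumr; apply: eq_bigr => i _; rewrite mxE mulrA.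
Qed.

Lemma dotZr c v w : dot v (c *: w) = c * dot v w.
Proof.
by rewrite /dot mulr_sumr; apply: eq_bigr => i _; rewrite mxE mulrCA.
Qed.

Lemma enorm0 : enorm (0 : 'rV[R]_n) = 0.
Proof. by rewrite -(scale0r 0) /enorm dotZl mul0r sqrtr0. Qed.

Lemma enorm_eq0 v : enorm v = 0 -> v = 0.
Proof.
move=> v0; have /eqP := sqr_enorm v; rewrite v0 expr0n/= eq_sym /dot.
rewrite psumr_eq0 => [/allP sq0|i _]; last by rewrite -expr2 sqr_ge0.
apply/rowP => i; rewrite mxE; apply/eqP.
by have := sq0 i (mem_index_enum i); rewrite mulf_eq0 orbb.
Qed.

Lemma enorm_unit v : enorm v != 0 -> enorm ((enorm v)^-1 *: v) = 1.
Proof.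
move=> v0; rewrite -[LHS]/(Num.sqrt (dot _ _)) dotZl dotZr -sqr_enorm.
by rewrite expr2 mulKf// mulVf// sqrtr1.
Qed.

Lemma qformZ J (F : 'I_J -> 'rV[R]_n -> 'rV[R]_n) j x c xi :
  qform F j x (c *: xi) = c ^+ 2 * qform F j x xi.
Proof. by rewrite /qform !sqr_enorm dotZr !dotZl dotZr; ring. Qed.

Lemma qform_eq0 J (F : 'I_J -> 'rV[R]_n -> 'rV[R]_n) j x xi :
  enorm (F j x) != 0 ->
  qform F j x xi = 0 <->
  enorm (F j x) ^+ 2 * enorm xi ^+ 2 = 2 * dot (F j x) xi ^+ 2.
Proof.
move=> F0; rewrite /qform dotZl.
have -> : 2 * ((enorm (F j x))^-1 * dot (F j x) xi) ^+ 2 - enorm xi ^+ 2 =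
    (2 * dot (F j x) xi ^+ 2 - enorm (F j x) ^+ 2 * enorm xi ^+ 2)
    / enorm (F j x) ^+ 2 by field.
split=> [/eqP|->]; last by rewrite subrr mul0r.
rewrite mulf_eq0 invr_eq0 sqrf_eq0 (negbTE F0) orbF subr_eq0.
by move=> /eqP ->.
Qed.

Lemma quad_elliptic_at_unit J (F : 'I_J -> 'rV[R]_n -> 'rV[R]_n) x :
  quad_elliptic_at (qform F) x <->
  forall xi, enorm xi = 1 -> ~ forall j, qform F j x xi = 0.
Proof.
split=> [ell xi xi1 /ell xi0|unit_ell xi q0].
  by move/eqP: xi1; rewrite xi0 enorm0 eq_sym oner_eq0.
apply: enorm_eq0; apply/eqP/negP => /negP xi0.
apply: (unit_ell _ (enorm_unit xi0)) => j.
by rewrite qformZ q0 mulr0.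
Qed.

End Homogeneity.

(** * Kernel of the principal symbol *)

Lemma rank_eq_colsP (K : fieldType) m N (A : 'M[K]_(m, N)) :
  \rank A = N <-> forall v : 'cV_N, A *m v = 0 -> v = 0.
Proof.
have rankE : \rank A = N <-> row_free A^T.
  by rewrite /row_free mxrank_tr; split=> [->|/eqP].
rewrite rankE; split=> [A_free v Av0|ker0].
  apply/eqP; rewrite -trmx_eq0 -(mulmx_free_eq0 _ A_free) -trmx_mul.
  by rewrite Av0 trmx0.
rewrite -kermx_eq0; apply/eqP/row_matrixP => i; rewrite row0.
apply/trmx_inj; rewrite trmx0; apply: ker0; apply/trmx_inj.
by rewrite trmx_mul trmxK trmx0 -row_mul mulmx_ker row0.
Qed.

(** The two rows of index j, abstracted over a field: N, d and e stand for
|F_j|^2, F_j.xi and |xi|^2.  The second equation is solved for b; what remains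
of the first one is a (N e - 2 d^2) / e, where iota^2 = -1 produces the minus
sign. *)
Lemma symbol_block_ker (K : fieldType) (iota N d g e a b : K) :
  iota ^+ 2 = -1 -> g != 0 -> e != 0 ->
  (N * a + 2 * g * (iota * d) * b = 0 /\ iota * d * a - g * e * b = 0) <->
  (b = iota * d * a / (g * e) /\ a * (N * e - 2 * d ^+ 2) = 0).
Proof.
move=> iota2 g0 e0; have ge0 : g * e != 0 by rewrite mulf_neq0.
have topE : N * a + 2 * g * (iota * d) * (iota * d * a / (g * e)) =
    a * (N * e - 2 * d ^+ 2) / e.
  by field: iota2; rewrite e0 g0.
split=> [[top bot]|[-> rest]].
  have bE : b = iota * d * a / (g * e).
    apply: (mulIf ge0); rewrite mulfVK// mulrC.
    by apply/esym/eqP; rewrite -subr_eq0 bot.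
  split=> //; apply: (mulIf (invr_neq0 e0)).
  by rewrite -topE -bE top mul0r.
split; first by rewrite topE rest mul0r.
by rewrite [g * e * _]mulrC mulfVK// subrr.
Qed.

Section Symbol.
Local Open Scope complex_scope.
Context {R : realType} {n J : nat}.
Variables (g : 'rV[R]_n -> R) (F : 'I_J -> 'rV[R]_n -> 'rV[R]_n).
Variables (x xi : 'rV[R]_n).

Lemma pJ_ker (a : 'cV[R[i]]_1) (b : 'cV[R[i]]_J) :
  pJ g F x xi *m col_mx a b = 0 <->
  forall j,
    (enorm (F j x) ^+ 2)%:C * a 0 0
      + (2 * g x)%:C * ('i * (dot (F j x) xi)%:C) * b j 0 = 0 /\
    'i * (dot (F j x) xi)%:C * a 0 0 - (g x * enorm xi ^+ 2)%:C * b j 0 = 0.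
Proof.
have diagE (d : 'I_J -> R[i]) j :
    \sum_l (\matrix_(j, l) (if l == j then d j else 0)) j l * b l 0
    = d j * b j 0.
  rewrite (bigD1 j)//= mxE eqxx big1 ?addr0// => l /negbTE lj.
  by rewrite mxE lj mul0r.
rewrite /pJ mul_block_col -[in X in X <-> _]col_mx0.
split=> [/eq_col_mx[top bot] j|eqs].
  move/matrixP/(_ j 0): top; move/matrixP/(_ j 0): bot.
  by rewrite !mxE !big_ord1 !diagE !mxE mulNr.
by congr col_mx; apply/matrixP => j k; rewrite (ord1 k) !mxE !big_ord1 !diagE
  !mxE ?mulNr; case: (eqs j).
Qed.

(** A nonzero kernel vector must have a nonzero delta gamma component a, since
a determines the delta u components; the factor a then cancels from what is left
of the equations, which becomes q_j = 0 for all j. *)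
Lemma rank_pJ :
  g x != 0 -> enorm xi != 0 -> (forall j, enorm (F j x) != 0) ->
  \rank (pJ g F x xi) = (1 + J)%N <-> ~ forall j, qform F j x xi = 0.
Proof.
move=> g0 xi0 F0; rewrite rank_eq_colsP.
have C0 (c : R) : c != 0 -> c%:C != 0 :> R[i] by rewrite fmorph_eq0.
have e0 : (enorm xi ^+ 2)%:C != 0 :> R[i] by rewrite C0// expf_neq0.
have blockE j (a b : R[i]) :
    ((enorm (F j x) ^+ 2)%:C * a
      + (2 * g x)%:C * ('i * (dot (F j x) xi)%:C) * b = 0 /\
    'i * (dot (F j x) xi)%:C * a - (g x * enorm xi ^+ 2)%:C * b = 0) <->
    (b = 'i * (dot (F j x) xi)%:C * a / ((g x)%:C * (enorm xi ^+ 2)%:C) /\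
    a * ((enorm (F j x) ^+ 2)%:C * (enorm xi ^+ 2)%:C
      - 2 * (dot (F j x) xi)%:C ^+ 2) = 0).
  rewrite (rmorphM (real_complex R) 2) (rmorphM (real_complex R) (g x)).
  rewrite (rmorph_nat (real_complex R) 2).
  by apply: symbol_block_ker => //; [exact: sqr_i | exact: C0].
have castE (N e d : R) :
    (N * e - 2 * d ^+ 2)%:C = N%:C * e%:C - 2 * d%:C ^+ 2 :> R[i].
  by rewrite rmorphB !rmorphM rmorph_nat.
split=> [ker0 q0|q_neq0 v].
  (* The kernel vector with a = 1; its b is the one forced by the second row. *)
  pose b : 'cV[R[i]]_J := \col_j
    ('i * (dot (F j x) xi)%:C * 1 / ((g x)%:C * (enorm xi ^+ 2)%:C)).
  have /ker0 : pJ g F x xi *m col_mx (const_mx 1) b = 0.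
    apply/pJ_ker => j; rewrite 2!mxE; apply/(blockE j); split=> //.
    rewrite mul1r -castE.
    by move/(qform_eq0 _ (F0 j)): (q0 j) => ->; rewrite subrr.
  move/(congr1 usubmx); rewrite col_mxKu linear0 => /matrixP/(_ 0 0)/eqP.
  by rewrite !mxE oner_eq0.
rewrite -[v]vsubmxK; set a := usubmx v; set b := dsubmx v.
move=> /pJ_ker eqs.
have a0 : a 0 0 = 0.
  apply/eqP/negP => /negP a0; apply: q_neq0 => j; apply/(qform_eq0 _ (F0 j)).
  have [_ /eqP] := (blockE j _ _).1 (eqs j).
  rewrite mulf_eq0 (negbTE a0)/= -castE fmorph_eq0 subr_eq0.
  by move=> /eqP.
have b0 j : b j 0 = 0.
  by have [-> _] := (blockE j _ _).1 (eqs j); rewrite a0 mulr0 mul0r.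
rewrite -col_mx0; congr col_mx; apply/matrixP => j k.
  by rewrite (ord1 j) (ord1 k) a0 mxE.
by rewrite (ord1 k) b0 mxE.
Qed.

End Symbol.

Theorem lemma2p2 (R : realType) (n J : nat) (hn : (2 <= n)%N)
  (X : set 'rV[R]_n) (hX : bounded_smooth_domain X)
  (gamma : 'rV[R]_n -> R) (hgamma : Ck_closure 1 X gamma)
  (hgamma_bounds : exists m M : R,
     0 < m /\ forall x, closure X x -> m <= gamma x <= M)
  (u f : 'I_J -> 'rV[R]_n -> R)
  (hu : forall j, Ck_closure 2 X (u j))
  (hpde : forall j x, X x -> div (fun y => gamma y *: grad (u j) y) x = 0)
  (hdirichlet : forall j x, frontier X x -> u j x = f j x)
  (hF : forall j, exists2 c : R,
     0 < c & forall x, closure X x -> c <= enorm (grad (u j) x)) :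
  DN_elliptic AJ_s AJ_t (AJ gamma (fun j => grad (u j))) (closure X)
  <-> quad_elliptic (qform (fun j => grad (u j))) (closure X).
Proof.
have [m [M [m0 gm]]] := hgamma_bounds.
have F0 x j : closure X x -> enorm (grad (u j) x) != 0.
  have [c c0 cF] := hF j => /cF cx.
  by rewrite gt_eqF// (lt_le_trans c0).
have g0 x : closure X x -> gamma x != 0.
  by move=> /gm/andP[mg _]; rewrite gt_eqF// (lt_le_trans m0).
have rankP x xi : closure X x -> enorm xi = 1 ->
    \rank (DN_symbol AJ_s AJ_t (AJ gamma (fun j => grad (u j))) x xi)
      = (1 + J)%N <->
    ~ forall j, qform (fun j => grad (u j)) j x xi = 0.
  move=> Xx xi1; rewrite AJ_symbolE; apply: rank_pJ; first exact: g0.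
    by rewrite xi1 oner_neq0.
  by move=> j; exact: F0.
split=> [ell x Xx|ell x xi Xx xi1].
  apply/quad_elliptic_at_unit => xi xi1; apply/(rankP x xi Xx xi1).
  exact: ell.
apply/(rankP x xi Xx xi1); apply: (quad_elliptic_at_unit _ x).1 xi1.
exact: ell.
Qed.
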